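(* Any finitely presented, parafree group is either large or infinite cyclic.
   Context: $\gamma_i(\cdot)$ denotes the $i$th term of the lower central series ($\gamma_1(G)=G$, $\gamma_{i+1}(G)=[\gamma_i(G),G]$). A group $G$ is weakly parafree if there is some non-trivial free group $F$ and, for each positive integer $i$, an isomorphism $F/\gamma_i(F)\to G/\gamma_i(G)$, such that these isomorphisms are compatible, i.e. they commute with the natural quotient maps $F/\gamma_{i}(F)\to F/\gamma_{i-1}(F)$ and $G/\gamma_{i}(G)\to G/\gamma_{i-1}(G)$ for all $i\ge 2$. A group is parafree if it is weakly parafree and residually nilpotent. A group is large if it has a finite index subgroup that admits a surjective homomorphism onto a free non-abelian group. *)

(* Defs.v *)
From HB Require Import structures.
From mathcomp Require Import all_boot.
From mathcomp Require Import all_classical.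

Set Implicit Arguments.
Unset Strict Implicit.
Unset Printing Implicit Defensive.

Local Open Scope classical_set_scope.
Local Open Scope group_scope.
Local Open Scope quotient_scope.

Definition is_subgroup (G : groupType) (H : set G) : Prop :=
  [/\ H 1, forall x y, H x -> H y -> H (x * y) & forall x, H x -> H x^-1].

Definition is_normal (G : groupType) (N : set G) : Prop :=
  is_subgroup N /\ forall x y, N x -> N (x ^ y).

Definition subgroup_gen (G : groupType) (A : set G) : set G :=
  smallest (@is_subgroup G) A.

Definition normal_closure (G : groupType) (A : set G) : set G :=
  smallest (@is_normal G) A.

Definition finite_index (G : groupType) (H : set G) : Prop :=
  finite_set [set [set x * h | h in H] | x in [set: G]].

Record normal_subgroup (G : groupType) := NormalSubgroup {
  nsubg_set :> set G;
  nsubgP : is_normal nsubg_set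
}.

Section Quotient.
Variables (G : groupType) (N : normal_subgroup G).

Definition coset_rel (x y : G) : bool := `[< nsubg_set N (x^-1 * y) >].

Let N1 : nsubg_set N 1. Proof. by case: (nsubgP N) => -[]. Qed.
Let NM x y : nsubg_set N x -> nsubg_set N y -> nsubg_set N (x * y).
Proof. by case: (nsubgP N) => -[_ NM _] _; apply: NM. Qed.
Let NV x : nsubg_set N x -> nsubg_set N x^-1.
Proof. by case: (nsubgP N) => -[_ _ NV] _; apply: NV. Qed.
Let NJ x y : nsubg_set N x -> nsubg_set N (x ^ y).
Proof. by case: (nsubgP N) => _; apply. Qed.

Lemma coset_rel_equiv : equiv_class_of coset_rel.
Proof.
split=> [x|x y|y x z].
- by apply/asboolP; rewrite mulVg.
- by apply/asboolP/asboolP => /NV; rewrite invgM invgK.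
- move=> /asboolP xy /asboolP yz; apply/asboolP.
  by have := NM xy yz; rewrite -mulgA mulVKg.
Qed.

Canonical coset_equiv := EquivRelPack coset_rel_equiv.

Definition quotient_group := {eq_quot coset_equiv}.

HB.instance Definition _ := Choice.on quotient_group.
HB.instance Definition _ := EqQuotient.on quotient_group.

Definition quotient_proj (x : G) : quotient_group := \pi_quotient_group x.

Lemma quotient_projP x y : quotient_proj x = quotient_proj y <-> nsubg_set N (x^-1 * y).
Proof.
split=> [/eqmodP/asboolP //|xy]; exact/eqmodP/asboolP.
Qed.

Lemma quotient_proj_repr (q : quotient_group) : quotient_proj (repr q) = q.
Proof. exact: reprK. Qed.

Definition quotient_mul (p q : quotient_group) : quotient_group :=
  quotient_proj (repr p * repr q).
Definition quotient_inv (p : quotient_group) : quotient_group :=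
  quotient_proj (repr p)^-1.

Lemma repr_quotient_proj x : nsubg_set N (x^-1 * repr (quotient_proj x)).
Proof. by apply/quotient_projP; rewrite quotient_proj_repr. Qed.

Lemma quotient_mulE x y :
  quotient_mul (quotient_proj x) (quotient_proj y) = quotient_proj (x * y).
Proof.
apply/esym/quotient_projP.
set x' := repr _; set y' := repr _.
have -> : (x * y)^-1 * (x' * y') = (x^-1 * x') ^ y * (y^-1 * y').
  by rewrite conjgE invgM !mulgA mulgK.
by apply: NM; [apply: NJ|]; apply: repr_quotient_proj.
Qed.

Lemma quotient_invE x : quotient_inv (quotient_proj x) = quotient_proj x^-1.
Proof.
apply/esym/quotient_projP; rewrite invgK.
set x' := repr _.
have -> : x * x'^-1 = ((x^-1 * x')^-1) ^ x^-1.
  by rewrite conjgE invgM !invgK !mulgA mulgK.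
exact/NJ/NV/repr_quotient_proj.
Qed.

Lemma quotient_mulA : associative quotient_mul.
Proof.
move=> p q r; rewrite -(quotient_proj_repr p) -(quotient_proj_repr q).
by rewrite -(quotient_proj_repr r) !quotient_mulE mulgA.
Qed.

Lemma quotient_mul1 : left_id (quotient_proj 1) quotient_mul.
Proof. by move=> p; rewrite -(quotient_proj_repr p) quotient_mulE mul1g. Qed.

Lemma quotient_mulr1 : right_id (quotient_proj 1) quotient_mul.
Proof. by move=> p; rewrite -(quotient_proj_repr p) quotient_mulE mulg1. Qed.

Lemma quotient_mulV : left_inverse (quotient_proj 1) quotient_inv quotient_mul.
Proof.
move=> p; rewrite -(quotient_proj_repr p) quotient_invE.
by rewrite quotient_mulE mulVg.
Qed.

Lemma quotient_mulrV : right_inverse (quotient_proj 1) quotient_inv quotient_mul.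
Proof.
move=> p; rewrite -(quotient_proj_repr p) quotient_invE.
by rewrite quotient_mulE mulgV.
Qed.

HB.instance Definition _ := isGroup.Build quotient_group
  quotient_mulA quotient_mul1 quotient_mulr1 quotient_mulV quotient_mulrV.

End Quotient.

(* The natural map G / M -> G / N; meaningful only when M is contained in N. *)
Definition quotient_map (G : groupType) (M N : normal_subgroup G)
    (q : quotient_group M) : quotient_group N :=
  quotient_proj N (repr q).

Lemma quotient_mapE (G : groupType) (M N : normal_subgroup G) (x : G) :
  M `<=` N -> quotient_map N (quotient_proj M x) = quotient_proj N x.
Proof. by move=> MN; apply/esym/quotient_projP/MN/repr_quotient_proj. Qed.

Definition group_hom (G H : groupType) (f : G -> H) : Prop :=
  {morph f : x y / x * y}.

Definition group_iso (G H : groupType) (f : G -> H) : Prop :=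
  group_hom f /\ bijective f.

Definition commutator_subgroup (G : groupType) (A B : set G) : set G :=
  subgroup_gen [set [~ x, y] | x in A & y in B].

(* Indexed from 1, as is usual; index 0 also yields the whole group. *)
Definition lower_central (G : groupType) (i : nat) : set G :=
  iter i.-1 (fun A => commutator_subgroup A [set: G]) [set: G].
Arguments lower_central G i : clear implicits.

Lemma is_subgroup_gen (G : groupType) (A : set G) :
  is_subgroup (subgroup_gen A).
Proof.
split=> [H [[]] //|x y xA yA H HA|x xA H HA].
- by case: (HA) => -[_ HM _] _; exact: HM (xA _ HA) (yA _ HA).
- by case: (HA) => -[_ _ HV] _; exact: HV (xA _ HA).
Qed.

Lemma lower_central_normal (G : groupType) (i : nat) :
  is_normal (lower_central G i).
Proof.
rewrite /lower_central; elim: i.-1 => [//|n [[N1 NM NV] NJ]] /=.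
set A := iter _ _ _ in N1 NM NV NJ *.
split=> [|x y]; first exact: is_subgroup_gen.
have [K1 KM KV] := is_subgroup_gen [set [~ x, y] | x in A & y in [set: G]].
suff: subgroup_gen [set [~ x, y] | x in A & y in [set: G]] `<=`
  [set z | commutator_subgroup A [set: G] (z ^ y)] by apply.
apply: smallest_sub.
  split=> [|u v Ku Kv|u Ku] /=; rewrite ?conj1g ?conjMg ?conjVg.
  - exact: K1.
  - exact: KM.
  - exact: KV.
move=> _ [a Aa [b _ <-]] /=; rewrite conjRg.
by move=> H [_]; apply; exists (a ^ y); [apply: NJ|exists (b ^ y)].
Qed.

Lemma lower_central_sub (G : groupType) (i : nat) :
  lower_central G i.+1 `<=` lower_central G i.
Proof.
case: i => [//|i]; rewrite /lower_central /=.
apply: smallest_sub; first by case: (lower_central_normal G i.+1).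
have [[N1 NM NV] NJ] := lower_central_normal G i.+1.
move=> _ [a Aa [b _ <-]]; exact: NM (NV _ Aa) (NJ _ _ Aa).
Qed.

Definition lcs (G : groupType) (i : nat) : normal_subgroup G :=
  NormalSubgroup (lower_central_normal G i).

Definition nilpotent (G : groupType) : Prop :=
  exists i, lower_central G i = [set 1].

Definition residually_nilpotent (G : groupType) : Prop :=
  forall x : G, x <> 1 ->
    exists N : normal_subgroup G, nilpotent (quotient_group N) /\ ~ nsubg_set N x.

Definition free_basis (F : groupType) (X : Type) (b : X -> F) : Prop :=
  forall (H : groupType) (f : X -> H),
    exists! phi : F -> H, group_hom phi /\ (forall x, phi (b x) = f x).

Definition free_group (F : groupType) : Prop :=
  exists (X : Type) (b : X -> F), free_basis b.

Lemma normal_closure_normal (G : groupType) (A : set G) :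
  is_normal (normal_closure A).
Proof.
split; first split=> [H [[[]]] //|x y xA yA H HA|x xA H HA].
- by case: (HA) => -[[_ HM _] _] _; exact: HM (xA _ HA) (yA _ HA).
- by case: (HA) => -[[_ _ HV] _] _; exact: HV (xA _ HA).
- by move=> x y xA H HA; case: (HA) => -[_ HJ] _; exact: HJ (xA _ HA).
Qed.

Definition nclosure (G : groupType) (A : set G) : normal_subgroup G :=
  NormalSubgroup (normal_closure_normal A).

Definition finitely_presented (G : groupType) : Prop :=
  exists (n : nat) (F : groupType) (b : 'I_n -> F) (R : seq F)
         (f : quotient_group (nclosure [set` R]) -> G),
    free_basis b /\ group_iso f.

Definition weakly_parafree (G : groupType) : Prop :=
  exists (F : groupType)
         (phi : forall i, quotient_group (lcs F i) -> quotient_group (lcs G i)),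
    [/\ free_group F,
        exists x : F, x <> 1,
        forall i, (1 <= i)%N -> group_iso (phi i) &
        forall i, (2 <= i)%N -> forall q : quotient_group (lcs F i),
          quotient_map (lcs G i.-1) (phi i q) =
          phi i.-1 (quotient_map (lcs F i.-1) q)].

Definition parafree (G : groupType) : Prop :=
  weakly_parafree G /\ residually_nilpotent G.

(* A homomorphism on the subgroup H is given by a function on G whose values
   outside H are irrelevant. *)
Definition large (G : groupType) : Prop :=
  exists (H : set G) (F : groupType) (f : G -> F),
    [/\ is_subgroup H /\ finite_index H,
        free_group F /\ (exists x y : F, ~ commute x y),
        forall x y, H x -> H y -> f (x * y) = f x * f y &
        f @` H = [set: F]].

Definition infinite_cyclic (G : groupType) : Prop :=
  infinite_set [set: G] /\ exists g : G, subgroup_gen [set g] = [set: G].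

(* Main.v *)
From HB Require Import structures.
From mathcomp Require Import all_boot all_order all_algebra.
From mathcomp Require Import all_classical.
From mathcomp Require Import perm generic_quotient zify.
Require Import Defs.

(** Write [G] as [F0 / <<R>>] with [F0] free of finite rank [s], and let [F] be
    the free group modelling the nilpotent quotients of [G].

    If [F] has rank one, it is abelian, so every [G / gamma_i(G)] is abelian and
    [gamma_2(G)] lies in every [gamma_i(G)]. Residual nilpotence then makes
    [gamma_2(G)] trivial, and [G] is isomorphic to its abelianisation, which is
    that of [F] ([infinite_cyclic_of_rank1]).

    If [F] has two distinct basis elements [x0] and [x1], the proof finds a
    finite cyclic cover of the presentation complex of [G] whose mod 2
    cohomology is large enough to contain a class supported away from a cut.

    - The coordinate of [x0] transfers to an epimorphism [chi : G -> Z], say with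
      [chi tau = 1]. For [N] a power of 2, the lamplighter group
      [(Z/2)^(Z/N) ><| Z] is nilpotent ([lamplighter_nilpotent]), so all
      homomorphisms from [F] to it transfer to [G] ([transfer_hom]). Sending [x0] to
      [(u, 1)] and [x1] to [(v, 0)], with [u] and [v] arbitrary, gives [2^(2N)]
      homomorphisms over [chi], that is, [2^(2N)] cocycles of [G] with values in
      [(Z/2)^(Z/N)].

    - Two of these cocycles agree on [tau], which is a condition on [N] bits, and
      agree for each of the [s] generators at the [2L + 1] positions within
      distance [L] of the cut of the cycle between [N - 1] and [0]. This is the
      pigeonhole principle, as soon as [N > s(2L + 1)]. Their sum is a nonzero
      cocycle [d] which vanishes on [tau] and on a window around the cut
      ([windowed_cocycle]). Here [L] depends on the presentation and not on [N].

    - The cocycle [d] describes a double cover of the [N]-cycle of Schreier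
      cosets, on which the generators act by moving along the cycle and by
      switching sheets at the positions given by [d]. Label the passages through
      the cut by a free generator [e false] on the first sheet and [e true] on
      the second. A relator that starts near the cut never switches sheets and
      crosses the cut algebraically zero times; one that starts far from the cut
      never reaches it. Hence the labels of each relator cancel, and the labelled
      action descends to [G] ([large_of_lamplighter]). The stabiliser of the
      point [(0, false)] has finite index; [tau ^+ N] runs once around the first
      sheet and reads [e false], while an element that switches sheets conjugates
      it to a loop reading [e true]. So the stabiliser maps onto a free group of
      rank two ([large_of_wreath]). *)

Set Implicit Arguments.
Unset Strict Implicit.
Unset Printing Implicit Defensive.

Import Order.TTheory GRing.Theory Num.Theory.

Local Open Scope classical_set_scope.
Local Open Scope group_scope.

(** * Homomorphisms, quotients and free groups *)

Section Hom.
Variables (G H : groupType) (f : G -> H).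
Hypothesis fM : group_hom f.

Lemma hom1 : f 1 = 1.
Proof. by apply: (mulgI (f 1)); rewrite -fM !mulg1. Qed.

Lemma homV x : f x^-1 = (f x)^-1.
Proof. by apply: (mulgI (f x)); rewrite -fM !mulgV hom1. Qed.

Lemma homX x n : f (x ^+ n) = f x ^+ n.
Proof. by elim: n => [|n IH]; rewrite ?hom1 // !expgS fM IH. Qed.

Lemma homR x y : f [~ x, y] = [~ f x, f y].
Proof. by rewrite /commg /conjg !(fM, homV). Qed.

Lemma is_normal_ker : is_normal [set x | f x = 1].
Proof.
split; first split=> [|x y /= fx fy|x /= fx] /=.
- exact: hom1.
- by rewrite fM fx fy mulg1.
- by rewrite homV fx invg1.
- by move=> x y /= fx; rewrite /conjg !fM homV fx mul1g mulVg.
Qed.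

Lemma is_subgroup_preim (B : set H) : is_subgroup B -> is_subgroup (f @^-1` B).
Proof.
case=> B1 BM BV; split=> [|x y|x] /=; rewrite ?hom1 ?fM ?homV //.
- exact: BM.
- exact: BV.
Qed.

End Hom.

Lemma hom_comp (G H K : groupType) (g : H -> K) (f : G -> H) :
  group_hom f -> group_hom g -> group_hom (g \o f).
Proof. by move=> fM gM x y; rewrite /= fM gM. Qed.

Lemma quotient_proj_hom (G : groupType) (N : normal_subgroup G) :
  group_hom (quotient_proj N).
Proof. by move=> x y; rewrite -quotient_mulE. Qed.

Lemma quotient_lift (G H : groupType) (N : normal_subgroup G) (f : G -> H) :
    group_hom f -> (forall x, nsubg_set N x -> f x = 1) ->
  exists2 g : quotient_group N -> H,
    group_hom g & forall x, g (quotient_proj N x) = f x.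
Proof.
move=> fM fN.
have fE x : f (repr (quotient_proj N x)) = f x.
  have /fN := repr_quotient_proj N x; rewrite fM (homV fM) => /mulg1_eq.
  by rewrite invgK.
exists (fun q => f (repr q)) => // p q.
rewrite -{1}[p]quotient_proj_repr -{1}[q]quotient_proj_repr.
by rewrite -quotient_proj_hom fE fM.
Qed.

Lemma subgroup_gen_sub (G : groupType) (A B : set G) :
  is_subgroup B -> A `<=` B -> subgroup_gen A `<=` B.
Proof. by move=> sB AB; apply: smallest_sub. Qed.

Lemma normal_closure_sub (G : groupType) (A B : set G) :
  is_normal B -> A `<=` B -> normal_closure A `<=` B.
Proof. by move=> sB AB; apply: smallest_sub. Qed.

(** A subgroup as a group in its own right: it serves as the target of the
    universal property in [free_generated]. *)
Section SubgroupType.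
Variables (G : groupType) (A : set G).
Hypothesis sA : is_subgroup A.

Record subgroup_type := SubgroupElt {
  subgroup_val :> G; subgroup_valP : `[< A subgroup_val >] }.
HB.instance Definition _ := [isSub for subgroup_val].
HB.instance Definition _ := [Choice of subgroup_type by <:].

Let inA x (Ax : A x) := SubgroupElt (asboolT Ax).
Let Aval (x : subgroup_type) : A x. Proof. exact/asboolP/subgroup_valP. Qed.
Let A1 : A 1. Proof. by case: sA. Qed.
Let AM x y : A x -> A y -> A (x * y). Proof. by case: sA => _ + _; apply. Qed.
Let AV x : A x -> A x^-1. Proof. by case: sA => _ _; apply. Qed.

Definition subgroup_one := inA A1.
Definition subgroup_mul (x y : subgroup_type) := inA (AM (Aval x) (Aval y)).
Definition subgroup_inv (x : subgroup_type) := inA (AV (Aval x)).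

Fact subgroup_mulA : associative subgroup_mul.
Proof. by move=> x y z; apply: val_inj; rewrite /= mulgA. Qed.
Fact subgroup_mul1 : left_id subgroup_one subgroup_mul.
Proof. by move=> x; apply: val_inj; rewrite /= mul1g. Qed.
Fact subgroup_mulr1 : right_id subgroup_one subgroup_mul.
Proof. by move=> x; apply: val_inj; rewrite /= mulg1. Qed.
Fact subgroup_mulV : left_inverse subgroup_one subgroup_inv subgroup_mul.
Proof. by move=> x; apply: val_inj; rewrite /= mulVg. Qed.
Fact subgroup_mulrV : right_inverse subgroup_one subgroup_inv subgroup_mul.
Proof. by move=> x; apply: val_inj; rewrite /= mulgV. Qed.

Definition subgroup_groupType : groupType :=
  HB.pack subgroup_type
    (isGroup.Build subgroup_type subgroup_mulA subgroup_mul1 subgroup_mulr1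
       subgroup_mulV subgroup_mulrV).

End SubgroupType.

Section FreeBasis.
Variables (F : groupType) (X : Type) (b : X -> F).
Hypothesis bF : free_basis b.

Lemma free_lift (H : groupType) (f : X -> H) :
  exists2 phi : F -> H, group_hom phi & forall x, phi (b x) = f x.
Proof. by have [phi [[? ?] _]] := bF f; exists phi. Qed.

Lemma free_hom_ext (H : groupType) (f g : F -> H) :
  group_hom f -> group_hom g -> (forall x, f (b x) = g (b x)) -> f =1 g.
Proof.
move=> fM gM fg x; have [h [_ hU]] := bF (f \o b).
have <- : h = f by apply: hU.
by have <- : h = g by apply: hU; split=> // y; rewrite -fg.
Qed.

(** The basis lifts to the subgroup; by uniqueness, the lift followed by the
    inclusion is the identity. *)
Lemma free_generated (A : set F) :
  is_subgroup A -> (forall x, A (b x)) -> forall w, A w.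
Proof.
move=> sA Ab.
have [phi phiM phib] := @free_lift (subgroup_groupType sA)
  (fun x => SubgroupElt (asboolT (Ab x))).
move=> w.
have -> : w = subgroup_val (phi w).
  apply: (@free_hom_ext F id (fun w => subgroup_val (phi w))) => //.
  - by move=> x y; rewrite phiM.
  - by move=> x; rewrite phib.
exact/asboolP/subgroup_valP.
Qed.

End FreeBasis.

(** The universal property of a presentation: a homomorphism from the free
    group that kills the relators factors through [G]. *)
Lemma finite_presentation (G : groupType) : finitely_presented G ->
  exists (s : nat) (F : groupType) (b : 'I_s -> F) (R : seq F) (pi : F -> G),
  [/\ free_basis b, group_hom pi, forall g, exists w, pi w = g,
      forall r, r \in R -> pi r = 1 &
      forall (H : groupType) (psi : F -> H), group_hom psi ->
        (forall r, r \in R -> psi r = 1) ->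
      exists2 psiG : G -> H, group_hom psiG & forall w, psiG (pi w) = psi w].
Proof.
case=> s [F] [b] [R] [f] [bF [fM [f' fK f'K]]].
exists s, F, b, R, (f \o quotient_proj _); split=> //.
- exact/hom_comp/fM/quotient_proj_hom.
- by move=> g; exists (repr (f' g)); rewrite /= quotient_proj_repr f'K.
- move=> r rR /=; rewrite -(hom1 fM); congr f.
  rewrite -(hom1 (quotient_proj_hom _)); apply/esym/quotient_projP.
  by rewrite invg1 mul1g => N [_]; apply.
move=> H psi psiM psiR.
have [x|q qM qE] := @quotient_lift F H (nclosure [set` R]) psi psiM.
  apply: (normal_closure_sub (is_normal_ker psiM)).
  by move=> r; apply: psiR.
exists (q \o f') => [|w]; last by rewrite /= fK qE.
apply: hom_comp qM => x y.
by rewrite -{1}[x]f'K -{1}[y]f'K -fM fK.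
Qed.

(** Killing the other basis elements leaves a free group on [x0] and [x1]; it is
    the free group onto which a subgroup of finite index will be mapped. *)
Lemma free_rank2 (F : groupType) (X : Type) (b : X -> F) (x0 x1 : X) :
    free_basis b -> x0 <> x1 ->
  exists (Q : groupType) (e : bool -> Q), free_basis e.
Proof.
move=> bF x01.
pose A := [set b x | x in [set x | x <> x0 /\ x <> x1]].
pose p := quotient_proj (nclosure A).
exists (quotient_group (nclosure A)).
exists (fun c => p (b (if c then x1 else x0))) => H f.
have [phi phiM phib] := free_lift bF (fun x =>
  if `[< x = x0 >] then f false else if `[< x = x1 >] then f true else 1).
have [x|q qM qE] := @quotient_lift F H (nclosure A) phi phiM.
  apply: (normal_closure_sub (is_normal_ker phiM)) => _ [y [/= y0 y1] <-] /=.
  by rewrite phib !asboolF.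
exists q; split; first split=> // c.
  rewrite qE phib; case: c; last by rewrite asboolT.
  by rewrite asboolF ?asboolT // => /esym.
move=> g [gM gE]; apply: funext => y.
rewrite -[y]quotient_proj_repr.
apply: (free_hom_ext bF (f := q \o p) (g := g \o p)).
- exact/hom_comp/qM/quotient_proj_hom.
- exact/hom_comp/gM/quotient_proj_hom.
move=> x /=; rewrite qE phib.
case: asboolP => [->|n0]; first by rewrite (gE false).
case: asboolP => [->|n1]; first by rewrite (gE true).
suff -> : p (b x) = 1 by rewrite (hom1 gM).
rewrite -(hom1 (quotient_proj_hom (nclosure A))).
apply/esym/quotient_projP; rewrite invg1 mul1g.
by move=> N [_]; apply; exists x.
Qed.

Lemma free_rank2_noncommuting (Q : groupType) (e : bool -> Q) :
  free_basis e -> exists x y : Q, ~ commute x y.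
Proof.
move=> eF; exists (e false), (e true) => e01.
pose i0 : 'I_3 := inord 0; pose i1 : 'I_3 := inord 1; pose i2 : 'I_3 := inord 2.
have [phi phiM phie] := @free_lift Q bool e eF {perm 'I_3}
  (fun c => if c then tperm i1 i2 else tperm i0 i1).
have /(congr1 (fun s : {perm 'I_3} => s i0)) :
    phi (e false * e true) = phi (e true * e false).
  by rewrite e01.
rewrite !phiM !phie !permM tpermL tpermL [tperm i1 i2 i0]tpermD ?tpermL;
  try move=> /(congr1 val);
  by rewrite /i0 /i1 /i2 -?val_eqE /= !inordK.
Qed.
(** * Wreath products *)

Record right_action (K : groupType) (I : finType) := RightAction {
  act :> I -> K -> I;
  act1 : forall i, act i 1 = i;
  actM : forall i x y, act i (x * y) = act (act i x) y
}.

Lemma actK K I (a : right_action K I) x : cancel (a^~ x) (a^~ x^-1).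
Proof. by move=> i; rewrite -actM mulgV act1. Qed.

(** The permutational wreath product. The label at [i] is the weight of the
    arrow from [i] to [a i (top p)], and the weights along a path multiply in
    the order in which it is travelled: these are monomial matrices. *)
Record wreath (K : groupType) (I : finType) (a : right_action K I)
  (Q : groupType) := Wreath { top : K; labels : {ffun I -> Q} }.
Arguments Wreath {K I} a {Q}.

Section WreathProduct.
Variables (K : groupType) (I : finType) (a : right_action K I) (Q : groupType).
Local Notation wreath := (wreath a Q).

Let to_pair (p : wreath) := (top p, labels p).
Let of_pair p : wreath := Wreath a p.1 p.2.
Fact wreath_pairK : cancel to_pair of_pair. Proof. by case. Qed.
HB.instance Definition _ := Choice.copy wreath (can_type wreath_pairK).

Lemma wreath_eq (p q : wreath) :
  top p = top q -> (forall i, labels p i = labels q i) -> p = q.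
Proof. by case: p q => [x u] [y v] /= -> uv; congr Wreath; apply/ffunP. Qed.

Definition wreath_one : wreath := Wreath a 1 [ffun=> 1].
Definition wreath_mul (p q : wreath) : wreath :=
  Wreath a (top p * top q) [ffun i => labels p i * labels q (a i (top p))].
Definition wreath_inv (p : wreath) : wreath :=
  Wreath a (top p)^-1 [ffun i => (labels p (a i (top p)^-1))^-1].

Fact wreath_mulA : associative wreath_mul.
Proof.
by move=> p q r; apply: wreath_eq => [|i] /=; rewrite ?ffunE ?mulgA // actM.
Qed.
Fact wreath_mul1 : left_id wreath_one wreath_mul.
Proof.
by move=> p; apply: wreath_eq => [|i] /=; rewrite ?ffunE ?mul1g // act1.
Qed.
Fact wreath_mulr1 : right_id wreath_one wreath_mul.
Proof.
by move=> p; apply: wreath_eq => [|i] /=; rewrite ?ffunE ?mulg1.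
Qed.
Fact wreath_mulV : left_inverse wreath_one wreath_inv wreath_mul.
Proof.
by move=> p; apply: wreath_eq => [|i] /=; rewrite ?ffunE ?mulVg.
Qed.
Fact wreath_mulrV : right_inverse wreath_one wreath_inv wreath_mul.
Proof.
by move=> p; apply: wreath_eq => [|i] /=; rewrite ?ffunE ?actK ?mulgV.
Qed.

HB.instance Definition _ := isGroup.Build wreath
  wreath_mulA wreath_mul1 wreath_mulr1 wreath_mulV wreath_mulrV.

Lemma topM (p q : wreath) : top (p * q) = top p * top q. Proof. by []. Qed.
Lemma topV (p : wreath) : top p^-1 = (top p)^-1. Proof. by []. Qed.
Lemma labelsM (p q : wreath) i :
  labels (p * q) i = labels p i * labels q (a i (top p)).
Proof. by rewrite ffunE. Qed.
Lemma labelsV (p : wreath) i : labels p^-1 i = (labels p (a i (top p)^-1))^-1.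
Proof. by rewrite ffunE. Qed.
Lemma labels1 i : labels (1 : wreath) i = 1.
Proof. by rewrite ffunE. Qed.

(** The base group is normal, and commutation by [q] measures how far its
    elements are from being invariant under [q]. *)
Lemma labels_comm (p q : wreath) i (j := a i (top q)^-1) : top p = 1 ->
  labels [~ p, q] i = (labels p i)^-1 * labels p j ^ labels q j.
Proof.
move=> p1; rewrite commgEl labelsM labelsV topV p1 invg1 act1.
rewrite !conjgE !labelsM labelsV topV p1.
by rewrite -[a (a i _) _]actM mulg1.
Qed.

End WreathProduct.

(** On the stabiliser of [i0], which has finite index because [I] is finite, the
    label at [i0] is a homomorphism. *)
Lemma large_of_wreath (G F K : groupType) (I : finType) (a : right_action K I)
    (psi : G -> wreath a F) (i0 : I) :
    group_hom psi -> free_group F -> (exists x y : F, ~ commute x y) ->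
    (forall x, exists2 g, a i0 (top (psi g)) = i0 & labels (psi g) i0 = x) ->
  large G.
Proof.
move=> psiM freeF ncF sur.
pose H : set G := [set g | a i0 (top (psi g)) = i0].
exists H, F, (fun g => labels (psi g) i0); split=> //; first split.
- split=> [|x y /= Hx Hy|x /= Hx]; rewrite /H /=.
  + by rewrite (hom1 psiM) act1.
  + by rewrite psiM topM actM Hx.
  + by rewrite (homV psiM) topV -{1}Hx actK.
- have finI : finite_set [set: I] by exact: finite_finset.
  pose C i : set G := [set g | a i0 (top (psi g))^-1 = i].
  apply: sub_finite_set (finite_image C finI) => _ [x _ <-].
  exists (a i0 (top (psi x))^-1) => //; apply/seteqP; split=> [g|_ [h Hh <-]].
    rewrite /C /= => gx; exists (x^-1 * g); last by rewrite mulVKg.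
    rewrite /H /= psiM (homV psiM) topM topV actM -gx.
    by rewrite -{2}[top (psi g)]invgK actK.
  rewrite /C /= psiM topM invgM actM; congr (a _ _).
  by rewrite -{1}Hh actK.
- by move=> x y Hx _; rewrite psiM labelsM Hx.
- by apply/seteqP; split=> // x _; have [g] := sur x; exists g.
Qed.

(** * The lamplighter group over the integers modulo N *)

(** The group of order two, for the states of the lamps and for the sheets of
    the double cover. *)
HB.instance Definition _ := isGroup.Build bool addbA addFb addbF addbb addbb.

Lemma mulbE (b c : bool) : b * c = b (+) c. Proof. by []. Qed.
Lemma invbE (b : bool) : b^-1 = b. Proof. by []. Qed.
Lemma onebE : 1 = false. Proof. by []. Qed.

(** The additive group of integers, written multiplicatively. *)
Definition intg : Type := int.
HB.instance Definition _ := Choice.on intg.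
HB.instance Definition _ := isGroup.Build intg
  (@addrA int) (@add0r int) (@addr0 int) (@addNr int) (@addrN int).

Lemma intgM (m n : intg) : m * n = (m + n)%R. Proof. by []. Qed.
Lemma intgV (m : intg) : m^-1 = (- m)%R. Proof. by []. Qed.
Lemma intg1 : (1 : intg) = 0%R. Proof. by []. Qed.

Definition zpow (Q : groupType) (g : Q) (n : intg) : Q :=
  match n with Posz m => g ^+ m | Negz m => g ^- m.+1 end.

Lemma zpow_hom (Q : groupType) (g : Q) : group_hom (zpow g).
Proof.
have S (n : int) : zpow g (n + 1)%R = zpow g n * g.
  case: n => [m|[|m]]; first by rewrite -PoszD addn1 /= expgSr.
    by rewrite /= mulVg.
  have -> : (Negz m.+1 + 1)%R = Negz m by lia.
  by rewrite /= (expgS g m.+1) invgM mulgVK.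
have P (n : int) : zpow g (n - 1)%R = zpow g n * g^-1.
  by apply: (mulIg g); rewrite -S subrK mulgVK.
move=> m n; rewrite intgM; elim/int_ind: n => [|n IH|n IH].
- by rewrite addr0 mulg1.
- by rewrite -addn1 PoszD addrA !S IH mulgA.
- by rewrite -addn1 PoszD opprD addrA !P IH mulgA.
Qed.

Section Shift.
Variable N : nat.

Definition shift (j : 'Z_N) (n : intg) : 'Z_N := (j + n%:~R)%R.
Fact shift1 j : shift j 1 = j.
Proof. exact: addr0. Qed.
Fact shiftM j m n : shift j (m * n) = shift (shift j m) n.
Proof. by rewrite /shift intgM intrD addrA. Qed.
Definition shift_action := RightAction shift1 shiftM.

Definition lamplighter := wreath shift_action bool.
HB.instance Definition _ := Group.on lamplighter.

(** An element of the lamplighter group with lamps [u] acts on the trivial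
    double cover of the cycle by moving along the cycle, and by switching sheets
    at the starting points where [u] is lit. *)
Definition toggle (i : 'Z_N * bool) (p : lamplighter) : 'Z_N * bool :=
  (shift i.1 (top p), i.2 (+) labels p i.1).
Fact toggle1 i : toggle i 1 = i.
Proof. by case: i => j b; rewrite /toggle labels1 addbF /= shift1. Qed.
Fact toggleM i p q : toggle i (p * q) = toggle (toggle i p) q.
Proof.
case: i => j b; rewrite /toggle labelsM topM /=.
by congr pair; [exact: shiftM|rewrite mulbE addbA].
Qed.
Definition toggle_action := RightAction toggle1 toggleM.

End Shift.

Lemma lower_central_filtration (G : groupType) (B : nat -> set G) :
    (forall i, is_subgroup (B i)) -> (forall x, B 0 x) ->
    (forall i x y, B i x -> B i.+1 [~ x, y]) ->
  forall i, lower_central G i.+1 `<=` B i.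
Proof.
move=> sB B0 BR; elim=> [//|i IH].
apply: (subgroup_gen_sub (sB _)) => _ [x Ax [y _ <-]].
exact/BR/IH.
Qed.

Section Lamplighter.
Variable k : nat.
Local Notation N := (2 ^ k.+1)%N.
Local Notation lamps := {ffun 'Z_N -> bool}.

Definition lamp_diff (u : lamps) : lamps := [ffun j => u j (+) u (j + 1)%R].

Lemma iter_lamp_diff_add m (u v : lamps) j :
  iter m lamp_diff [ffun i => u i (+) v i] j =
  iter m lamp_diff u j (+) iter m lamp_diff v j.
Proof.
elim: m j => [|m IH] j; first by rewrite ffunE.
by rewrite !iterS !ffunE !IH addbACA.
Qed.

Lemma iter_lamp_diff_shift m (u : lamps) (a j : 'Z_N) :
  iter m lamp_diff [ffun i => u (i + a)%R] j = iter m lamp_diff u (j + a)%R.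
Proof.
elim: m j => [|m IH] j; first by rewrite ffunE.
by rewrite !iterS !ffunE !IH addrAC.
Qed.

(** Freshman's dream for the operator [T + 1], where [T] is the shift. *)
Lemma iter_lamp_diff_expn m (u : lamps) j :
  iter (2 ^ m)%N lamp_diff u j = u j (+) u (j + (2 ^ m)%N%:R)%R.
Proof.
elim: m u j => [|m IH] u j; first by rewrite /= ffunE.
rewrite (expnS 2 m) mul2n -addnn iterD !IH natrD addrA.
by rewrite -addbA; congr (_ (+) _); rewrite addbA addbb.
Qed.

Lemma iter_lamp_diff_order (u : lamps) j : iter N lamp_diff u j = false.
Proof.
rewrite iter_lamp_diff_expn pchar_Zp ?addr0 ?addbb //.
by rewrite -{1}(expn0 2) ltn_exp2l.
Qed.

Lemma lamp_diff_const (u : lamps) :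
  (forall j, lamp_diff u j = false) -> forall i j, u i = u j.
Proof.
move=> Du i j; suff uD m : u (j + m%:R)%R = u j.
  by rewrite -(uD (i - j)%R) natr_Zp addrC subrK.
elim: m => [|m IH]; first by rewrite addr0.
have := Du (j + m%:R)%R; rewrite ffunE IH -addrA natr1.
by case: (u j); case: (u _).
Qed.

(** The shift [T] satisfies [(T - 1) ^ N = T ^ N - 1 = 0] in characteristic 2,
    because [N] is a power of 2; each commutation applies a multiple of
    [T - 1]. *)
Lemma lamplighter_nilpotent : lower_central (lamplighter N) N.+2 = [set 1].
Proof.
pose B i : set (lamplighter N) := if i is i'.+1 then
  [set p | top p = 1 /\
    forall j, iter (N - i')%N lamp_diff (labels p) j = false]
  else setT.
have sB i : is_subgroup (B i).
  case: i => [//|i]; split.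
  - split=> // j; elim: (N - i)%N j => [|m IH] j; first by rewrite ffunE.
    by rewrite iterS ffunE !IH.
  - move=> p q [p1 pD] [q1 qD]; split=> [|j]; first by rewrite topM p1 q1 mulg1.
    rewrite (_ : labels _ = [ffun l => labels p l (+) labels q l]).
      by rewrite iter_lamp_diff_add pD qD.
    by apply/ffunP => l; rewrite labelsM p1 act1 ffunE.
  - move=> p [p1 pD]; split=> [|j]; first by rewrite topV p1 invg1.
    rewrite (_ : labels _ = labels p) //.
    by apply/ffunP => l; rewrite labelsV p1 invg1 act1.
apply/seteqP; split=> [p|_ ->]; last first.
  by case: (lower_central_normal (lamplighter N) N.+2) => -[].
move=> /(@lower_central_filtration (lamplighter N) B sB) [|i q r|].
- by [].
- case: i => [_|i [q1 qD]].
    split=> [|j]; last by rewrite subn0 iter_lamp_diff_order.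
    rewrite /commg /conjg !topM !topV; apply: (can_inj (@opprK int)).
    by rewrite !intgM !intgV intg1; lia.
  have [t1 lE] : top [~ q, r] = 1 /\ labels [~ q, r] =
     [ffun l => labels q l (+) [ffun l => labels q (l + (- top r)%:~R)%R] l].
    split; first by rewrite /commg /conjg !topM !topV q1 invg1 !mul1g mulVg.
    apply/ffunP => l; rewrite labels_comm // conjgE !mulbE !invbE !ffunE.
    by congr (_ (+) _); rewrite addbC -addbA addbb addbF.
  split=> [//|j]; rewrite lE iter_lamp_diff_add iter_lamp_diff_shift.
  have := qD; case E : (N - i)%N => [|m] qD'.
    have -> : (N - i.+1)%N = 0 by lia.
    by rewrite /= !(qD' _).
  have -> : (N - i.+1)%N = m by lia.
  pose j' := (j + (- top r)%:~R)%R.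
  by rewrite (@lamp_diff_const (iter m lamp_diff (labels q)) qD' j j') addbb.
- rewrite /B subnn => p1 pD; apply: wreath_eq => // j.
  by rewrite labels1 onebE pD.
Qed.

End Lamplighter.

(** * Lifting the lamplighter action to a covering *)

Section Wrap.
Variable N : nat.
Hypothesis N1 : (1 < N)%N.

(** The number of times, with sign, that the path of length [n] starting at
    [j] runs around the cycle of length [N] past the point between [N - 1]
    and [0]. *)
Definition wrap (j : 'Z_N) (n : intg) : intg :=
  ((Posz j + n) %/ (Posz N))%Z.

Lemma shift_val (j : 'Z_N) (n : intg) :
  Posz (shift j n) = ((Posz j + n) %% (Posz N))%Z.
Proof.
have N0 : (Posz N != 0)%R by lia.
have -> : shift j n = shift j (n %% (Posz N))%Z.
  rewrite /shift; congr (_ + _)%R; rewrite {1}(divz_eq n (Posz N)) intrD intrM.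
  by rewrite [X in (_ * X)%R](_ : _ = 0%R) ?mulr0 ?add0r //; apply: pchar_Zp.
have [r rE] : exists r : nat, (n %% (Posz N))%Z = r.
  by exists (`|(n %% (Posz N))%Z|)%N; rewrite gez0_abs ?modz_ge0.
rewrite -modzDmr rE -PoszD modz_nat /shift; congr Posz.
rewrite -[(r%:~R)%R]/(r%:R)%R -{1}(natr_Zp j) -natrD val_Zp_nat //.
Qed.

Lemma wrapD j m n : wrap j (m * n) = wrap j m * wrap (shift j m) n.
Proof.
have N0 : (Posz N != 0)%R by lia.
rewrite /wrap shift_val !intgM.
rewrite {1}addrA {1}(divz_eq (Posz j + m) (Posz N)) -addrA.
by rewrite divzMDl.
Qed.

Lemma wrap0 j : wrap j 1 = 1.
Proof.
rewrite /wrap intg1 addr0 divz_nat divn_small //.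
by rewrite -[X in (_ < X)%N](Zp_cast N1).
Qed.

Lemma wrapV j n : wrap j n^-1 = (wrap (shift j n^-1) n)^-1.
Proof.
by apply/(mulIg (wrap (shift j n^-1) n)); rewrite -wrapD mulVg wrap0 mulVg.
Qed.

(** Paths of length at most [L] from [j] do not cross the cut. *)
Definition far (L : nat) (j : 'Z_N) : Prop :=
  forall n : intg, (`|(n : int)| <= L)%N -> wrap j n = 1.

Lemma far_le L M j : (M <= L)%N -> far L j -> far M j.
Proof. by move=> ML fL n nM; apply: fL; apply: leq_trans ML. Qed.

Lemma far_shift L j (n : intg) :
  far (L + `|(n : int)|)%N (shift j n) -> far L j.
Proof.
move=> f.
have nj : wrap j n = 1.
  have := wrapD (shift j n) n^-1 n; rewrite mulVg wrap0 -shiftM mulgV shift1.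
  by rewrite f ?mul1g // intgV abszN leq_addl.
move=> m mL; rewrite -[m](mulVKg n) wrapD nj mul1g f //.
rewrite intgM intgV; lia.
Qed.


End Wrap.

Section Tight.
Variables (N : nat) (Q : groupType) (e : bool -> Q).
Hypothesis N1 : (1 < N)%N.
Local Notation P := (wreath (toggle_action N) Q).

(** A [tight] element switches sheets only at positions that are [M]-far from the
    cut, and its label at [(j, c)] is what a path that stays on the sheet [c]
    would read. The two conditions are compatible with products because a path
    that does switch sheets crosses the cut neither before nor after: this is
    why the margin [M] is part of the definition. *)
Definition tight (M : nat) (p : P) : Prop := forall j : 'Z_N,
  (labels (top p) j -> far M j) /\
  forall c, labels p (j, c) = zpow (e c) (wrap j (top (top p))).

Lemma tight_le L M (p : P) : (M <= L)%N -> tight L p -> tight M p.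
Proof.
by move=> ML tL j; have [f l] := tL j; split=> // /f; apply: far_le.
Qed.

Lemma tight1 M : tight M 1.
Proof.
by move=> j; split=> [|c]; rewrite labels1 // (wrap0 N1).
Qed.

Lemma tightM L M (p q : P) :
    (M + `|(top (top p) : int)| + `|(top (top q) : int)| <= L)%N ->
  tight L p -> tight L q -> tight M (p * q).
Proof.
move=> LM tp tq j; have [fp lp] := tp j.
have [fq lq] := tq (shift j (top (top p))).
split=> [|c].
  rewrite !topM labelsM => /=; case E : (labels (top p) j).
    by move=> _; apply: far_le (fp E); lia.
  move=> /= /fq fj; apply: (@far_shift N N1 _ _ (top (top p))).
  by apply: far_le fj; lia.
rewrite labelsM lp !topM wrapD //=.
rewrite -[toggle _ _]/(shift j (top (top p)), c (+) labels (top p) j) lq.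
case E : (labels (top p) j); last by rewrite addbF zpow_hom.
have := fp E; set m := top (top p); set n := top (top q) => fj.
have jm : wrap j m = 1 by apply: fj; lia.
have jmn : wrap (shift j m) n = 1.
  by rewrite -[LHS]mul1g -jm -wrapD // fj // intgM; lia.
by rewrite jm jmn !mulg1.
Qed.

Lemma tightV L M (p : P) :
  (M + `|(top (top p) : int)| <= L)%N -> tight L p -> tight M p^-1.
Proof.
move=> LM tp j; set m := top (top p).
have [fp lp] := tp (shift j m^-1).
split=> [|c].
  rewrite topV labelsV invbE => /fp fj.
  apply: (@far_shift N N1 _ _ m^-1); apply: far_le fj.
  by rewrite intgV abszN.
rewrite labelsV !topV -/m.
have tE : toggle_action N (j, c) (top p)^-1 =
    (shift j m^-1, c (+) labels (top p) (shift j m^-1)).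
  by rewrite /= /toggle topV labelsV.
rewrite tE lp -/m wrapV //.
case E : (labels (top p) (shift j m^-1)); last first.
  by rewrite addbF (homV (zpow_hom _)).
have -> : wrap (shift j m^-1) m = 1 by apply: (fp E); lia.
by rewrite !invg1.
Qed.

End Tight.

(** A word in the generators is as tight as desired when the generators are
    tight enough, with a bound [L] that does not depend on the length [N] of the
    cycle. *)
Lemma tight_word (s : nat) (F : groupType) (b : 'I_s -> F) (Q : groupType)
    (e : bool -> Q) (chi : F -> intg) (w : F) (M : nat) :
    free_basis b -> group_hom chi ->
  exists L, forall N (Phi : F -> wreath (toggle_action N) Q),
    (1 < N)%N -> group_hom Phi -> (forall x, top (top (Phi x)) = chi x) ->
    (forall k, tight e L (Phi (b k))) -> tight e M (Phi w).
Proof.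
move=> bF chiM; move: w M.
apply: (free_generated bF (A := [set w | forall M, exists L, forall N Phi, _])).
- split=> [M|w v Hw Hv M|w Hw M].
  + by exists 0 => N Phi N1 PhiM _ _; rewrite (hom1 PhiM); apply: tight1.
  + have [L1 H1] := Hw (M + `|(chi w : int)| + `|(chi v : int)|)%N.
    have [L2 H2] := Hv (M + `|(chi w : int)| + `|(chi v : int)|)%N.
    exists (maxn L1 L2) => N Phi N1 PhiM Phic Phib; rewrite PhiM.
    apply: (tightM N1 (leqnn _)); rewrite !Phic.
      apply: H1 => // k; apply: tight_le (Phib k); exact: leq_maxl.
    apply: H2 => // k; apply: tight_le (Phib k); exact: leq_maxr.
  + have [L H] := Hw (M + `|(chi w : int)|)%N.
    exists L => N Phi N1 PhiM Phic Phib; rewrite (homV PhiM).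
    by apply: (tightV N1 (leqnn _)); rewrite Phic; apply: H.
- by move=> k M; exists M => N Phi N1 _ _; apply.
Qed.

(** * Largeness from a lamplighter homomorphism with a window *)

Lemma tight_words (s : nat) (F : groupType) (b : 'I_s -> F) (Q : groupType)
    (e : bool -> Q) (chi : F -> intg) (ws : seq F) :
    free_basis b -> group_hom chi ->
  exists L0, forall L N (Phi : F -> wreath (toggle_action N) Q), (L0 <= L)%N ->
    (1 < N)%N -> group_hom Phi -> (forall x, top (top (Phi x)) = chi x) ->
    (forall k, tight e L (Phi (b k))) ->
  forall w, w \in ws -> tight e 0 (Phi w).
Proof.
move=> bF chiM; elim: ws => [|w ws [L1 H1]]; first by exists 0.
have [L2 H2] := tight_word e w 0 bF chiM.
exists (maxn L1 L2) => L N Phi; rewrite geq_max => /andP[L1L L2L].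
move=> N1 PhiM Phic Phib v; rewrite in_cons.
move=> /orP[/eqP ->|]; last exact: (H1 L).
by apply: H2 => // k; apply: tight_le (Phib k).
Qed.

Section Loops.
Variables (N : nat) (Q : groupType) (e : bool -> Q).
Hypothesis N1 : (1 < N)%N.
Local Notation P := (wreath (toggle_action N) Q).

Lemma shift_order (j : 'Z_N) : shift j (Posz N) = j.
Proof.
by rewrite /shift [X in (_ + X)%R](_ : _ = 0%R) ?addr0 //; apply: pchar_Zp.
Qed.

Lemma wrap_order : wrap (0%R : 'Z_N) (Posz N) = Posz 1.
Proof. by rewrite /wrap /= add0r divzz; lia. Qed.

Lemma tight_expg (p : P) n :
    tight e 0 p -> top (top p) = Posz 1 ->
    (forall j, labels (top p) j = false) ->
  [/\ top (top (p ^+ n)) = Posz n, forall j, labels (top (p ^+ n)) j = false &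
      forall j c, labels (p ^+ n) (j, c) = zpow (e c) (wrap j (Posz n))].
Proof.
move=> tp p1 p0; elim: n => [|n [IH1 IH0 IHl]].
  by split=> // [j|j c]; rewrite labels1 // (wrap0 N1).
rewrite expgSr; split=> [|j|j c].
- by rewrite !topM IH1 p1 intgM -PoszD addn1.
- by rewrite topM labelsM IH0 p0.
rewrite labelsM IHl.
have -> : toggle_action N (j, c) (top (p ^+ n)) = (shift j (Posz n), c).
  by rewrite /= /toggle IH1 IH0 addbF.
have [_ ->] := tp (shift j (Posz n)).
by rewrite p1 -zpow_hom -wrapD // intgM -PoszD addn1.
Qed.

End Loops.

Lemma stabilizer_labels_subgroup (G F K : groupType) (I : finType)
    (a : right_action K I) (psi : G -> wreath a F) (i0 : I) : group_hom psi ->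
  is_subgroup
    [set x | exists2 g, a i0 (top (psi g)) = i0 & labels (psi g) i0 = x].
Proof.
move=> psiM; split=> [|_ _ [g gi <-] [h hi <-]|_ [g gi <-]].
- by exists 1; rewrite (hom1 psiM) ?act1 ?labels1.
- by exists (g * h); rewrite psiM ?topM ?actM ?labelsM gi.
- have gi' : a i0 (top (psi g))^-1 = i0 by rewrite -{1}gi actK.
  by exists g^-1; rewrite (homV psiM) ?topV ?labelsV gi'.
Qed.

Section LargeOfLamplighter.
Variables (G : groupType) (s : nat) (F : groupType) (b : 'I_s -> F).
Variables (R : seq F) (pi : F -> G).
Hypotheses (bF : free_basis b) (piM : group_hom pi).
Hypothesis pi_sur : forall g, exists w, pi w = g.
Hypothesis piR : forall r, r \in R -> pi r = 1.
Hypothesis pi_lift : forall (H : groupType) (psi : F -> H), group_hom psi ->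
  (forall r, r \in R -> psi r = 1) ->
  exists2 psiG : G -> H, group_hom psiG & forall w, psiG (pi w) = psi w.
Variables (chi : G -> intg) (tau : G).
Hypotheses (chiM : group_hom chi) (chi_tau : chi tau = Posz 1).
Variables (Q : groupType) (e : bool -> Q).
Hypothesis eQ : free_basis e.

(** A homomorphism to a lamplighter group whose lamps stay off in a window of
    radius [L] around the cut, on each generator, lifts to the wreath product by
    a free group over the double cover: by tightness, the lift of a relator is
    trivial as soon as its image in the lamplighter group is. *)
Lemma large_of_lamplighter :
  exists L, forall N (psi : G -> lamplighter N), (1 < N)%N -> group_hom psi ->
    (forall g, top (psi g) = chi g) -> (forall j, labels (psi tau) j = false) ->
    (forall k j, labels (psi (pi (b k))) j -> far L j) ->
    (exists k j, labels (psi (pi (b k))) j) ->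
  large G.
Proof.
have [wt wtE] := pi_sur tau.
have [L0 L0P] := tight_words e (wt :: R) bF (hom_comp piM chiM).
(* The second term makes a generator that switches sheets avoid the cut. *)
pose L := maxn L0 (\max_(k < s) `|(chi (pi (b k)) : int)|)%N.
exists L => N psi N1 psiM psi_top psi_tau psi_far [k [j kj]].
have [Phi PhiM Phib] := free_lift bF (fun k => Wreath (toggle_action N)
  (psi (pi (b k))) [ffun i => zpow (e i.2) (wrap i.1 (chi (pi (b k))))]).
have Phi_top w : top (Phi w) = psi (pi w).
  apply: (free_hom_ext bF
    (f := fun w => top (Phi w)) (g := fun w => psi (pi w))).
  - by move=> x y; rewrite PhiM topM.
  - exact: hom_comp piM psiM.
  - by move=> l; rewrite Phib.
have Phi_gen l : tight e L (Phi (b l)).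
  move=> i; rewrite Phib /=; split; first exact: psi_far.
  by move=> c; rewrite ffunE psi_top.
have Phi_tight w : w \in wt :: R -> tight e 0 (Phi w).
  apply: L0P Phi_gen w => //; first exact: leq_maxl.
  by move=> x; rewrite Phi_top psi_top.
have [|PhiG PhiGM PhiGE] := pi_lift PhiM.
  move=> r rR; have rt : tight e 0 (Phi r).
    by apply: Phi_tight; rewrite in_cons rR orbT.
  have r1 : top (Phi r) = 1 by rewrite Phi_top piR // (hom1 psiM).
  apply: wreath_eq => // -[i c]; have [_ ->] := rt i.
  by rewrite r1 labels1 (wrap0 N1).
have PhiG_top g : top (PhiG g) = psi g.
  by have [w <-] := pi_sur g; rewrite PhiGE Phi_top.
have tau_tight : tight e 0 (PhiG tau).
  by rewrite -wtE PhiGE; apply: Phi_tight; apply: mem_head.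
have tauX n : [/\ top (top (PhiG (tau ^+ n))) = Posz n,
    forall i, labels (top (PhiG (tau ^+ n))) i = false &
    forall i c, labels (PhiG (tau ^+ n)) (i, c) = zpow (e c) (wrap i (Posz n))].
  rewrite (homX PhiGM); apply: tight_expg => //.
    by rewrite PhiG_top psi_top.
  by move=> i; rewrite PhiG_top.
have tau_act n i c :
    toggle_action N (i, c) (top (PhiG (tau ^+ n))) = (shift i (Posz n), c).
  by have [t0 tl _] := tauX n; rewrite /= /toggle t0 tl addbF.
pose i0 : 'Z_N * bool := (0%R, false).
have nc := free_rank2_noncommuting eQ.
have freeQ : free_group Q by exists bool, e.
apply: (large_of_wreath (i0 := i0) PhiGM freeQ nc).
have sA := stabilizer_labels_subgroup i0 PhiGM.
apply: (free_generated eQ sA).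
have loop c : labels (PhiG (tau ^+ N)) (0%R, c) = e c.
  by have [_ _ ->] := tauX N; rewrite wrap_order.
case; last first.
  by exists (tau ^+ N); rewrite ?tau_act ?shift_order ?loop.
pose chik := chi (pi (b k)).
(* [h] travels to a position [j] where the sheet is switched, switches, and
   returns to [0] in the positive direction on the other sheet. *)
pose m := (N - shift j chik)%N.
pose h := tau ^+ (j : nat) * (pi (b k) * tau ^+ m).
have jN (i : 'Z_N) : (i < N)%N by rewrite -[X in (_ < X)%N](Zp_cast N1).
have tj : shift (0%R : 'Z_N) (Posz j) = j.
  by rewrite /shift add0r; apply: (natr_Zp j).
have tm : shift (shift j chik) (Posz m) = 0%R.
  rewrite /m /shift -{1}[(j + _)%R]natr_Zp -[(Posz _)%:~R%R]/((_)%:R)%R -natrD.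
  by rewrite subnKC; [apply: pchar_Zp|exact/ltnW/jN].
have bk_act :
    toggle_action N (j, false) (top (PhiG (pi (b k)))) = (shift j chik, true).
  by rewrite /= /toggle PhiG_top psi_top kj.
have h_act : toggle_action N i0 (top (PhiG h)) = (0%R, true).
  by rewrite /h !PhiGM !topM !actM (tau_act j 0%R) tj bk_act (tau_act m) tm.
have [q h_lab] : exists q, labels (PhiG h) i0 = zpow (e true) q.
  (* The cut is only crossed on the way back, so [h] reads a power of [e true]. *)
  exists (wrap (shift j chik) (Posz m)).
  rewrite /h !PhiGM !labelsM (tau_act j 0%R) tj bk_act PhiGE.
  have [_ _ ->] := tauX j; have [_ _ ->] := tauX m.
  have [fj ->] := Phi_gen k j.
  rewrite [wrap 0%R _](_ : _ = 1); last first.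
    by rewrite /wrap /= add0r divz_nat divn_small ?jN.
  rewrite (fj _ _) ?mul1g //; first by rewrite Phib.
  rewrite Phib /= psi_top; apply: leq_trans (leq_maxr _ _).
  exact: (leq_bigmax k).
clearbody h; exists (h * (tau ^+ N * h^-1)).
  rewrite !PhiGM !topM !actM h_act tau_act (shift_order N1).
  by rewrite (homV PhiGM) topV -h_act actK.
rewrite !PhiGM !labelsM h_act loop tau_act (shift_order N1) (homV PhiGM).
rewrite labelsV -h_act actK h_lab -(homV (zpow_hom _)).
rewrite -[e true]/(zpow (e true) (Posz 1)) -!zpow_hom.
by congr zpow; rewrite !intgM intgV; lia.
Qed.

End LargeOfLamplighter.

(** The positions that are not [L]-far lie between [-L] and [L], so their number
    is bounded independently of [N]. *)
Lemma far_window N (L : nat) (j : 'Z_N) : (1 < N)%N ->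
  (forall i : 'I_L.*2.+1, j <> shift 0%R (Posz i - Posz L)%R) -> far L j.
Proof.
move=> N1 jL.
have jN : (j < N)%N by rewrite -[X in (_ < X)%N](Zp_cast N1).
have sj : shift (0%R : 'Z_N) (Posz j) = j.
  by rewrite /shift add0r; apply: (natr_Zp j).
have jge : (L <= j)%N.
  rewrite leqNgt; apply/negP => jlt.
  have iP : (j + L < L.*2.+1)%N by lia.
  by case: (jL (Ordinal iP)); rewrite -{1}sj; congr shift => /=; lia.
have jlt : (j + L < N)%N.
  rewrite ltnNge; apply/negP => jge'.
  have iP : (j + L - N < L.*2.+1)%N by lia.
  case: (jL (Ordinal iP)); rewrite -[RHS](shift_order N1) -shiftM -{1}sj.
  congr shift; change (Posz j = Posz (j + L - N) - Posz L + Posz N)%R; lia.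
by move=> n nL; rewrite /wrap divz_small //; lia.
Qed.

(** * Cocycles vanishing on a window *)

Lemma lamp_sum_hom (G : groupType) (chi : G -> intg) N
    (f g : G -> lamplighter N) :
    group_hom f -> group_hom g ->
    (forall x, top (f x) = chi x) -> (forall x, top (g x) = chi x) ->
  group_hom (fun x => Wreath (shift_action N) (chi x)
    [ffun j => labels (f x) j (+) labels (g x) j] : lamplighter N).
Proof.
move=> fM gM fc gc x y; apply: wreath_eq => [|j].
  by rewrite topM /= -!fc fM topM.
by rewrite labelsM !ffunE fM gM !labelsM !mulbE fc gc addbACA.
Qed.

(** There are [2 ^ (2N)] cocycles, but at most [2 ^ (N + s (2L + 1))] possible
    restrictions to [tau] and to the windows of the generators. Two distinct
    cocycles with the same restriction have a nonzero sum [d]. *)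
Lemma windowed_cocycle (G F : groupType) (s : nat) (b : 'I_s -> F) (pi : F -> G)
    (chi : G -> intg) (tau : G) (L N : nat)
    (psi : {ffun 'Z_N -> bool} * {ffun 'Z_N -> bool} -> G -> lamplighter N) :
    free_basis b -> group_hom pi -> (forall g, exists w, pi w = g) ->
    (1 < N)%N -> (s * L.*2.+1 < N)%N ->
    (forall uv, group_hom (psi uv)) -> (forall uv g, top (psi uv g) = chi g) ->
    (forall uv uv', psi uv =1 psi uv' -> uv = uv') ->
  exists d : G -> lamplighter N,
    [/\ group_hom d, forall g, top (d g) = chi g,
        forall j, labels (d tau) j = false,
        forall k j, labels (d (pi (b k))) j -> far L j &
        exists k j, labels (d (pi (b k))) j].
Proof.
move=> bF piM pi_sur N1 sN psiM psi_top psi_inj.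
pose data uv := (labels (psi uv tau), [ffun ki : 'I_s * 'I_L.*2.+1 =>
  labels (psi uv (pi (b ki.1))) (shift 0%R (Posz ki.2 - Posz L)%R)]).
have /injectivePn [uv [uv' uvn [dtau dwin]]] : ~~ injectiveb data.
  apply/negP => /injectiveP/leq_card.
  rewrite !card_prod !card_ffun card_prod !card_ord card_bool.
  by rewrite Zp_cast // leq_pmul2l ?expn_gt0 // leq_exp2l // leqNgt sN.
exists (fun x => Wreath (shift_action N) (chi x)
    [ffun j => labels (psi uv x) j (+) labels (psi uv' x) j]); split=> //.
- exact: lamp_sum_hom.
- by move=> j; rewrite ffunE dtau addbb.
- move=> k j; rewrite ffunE => kj; apply: far_window => // i ji.
  have := congr1 (fun f : {ffun _ -> _} => f (k, i)) dwin.
  by rewrite !ffunE /= -ji => E; rewrite E addbb in kj.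
apply: contrapT => none; case/eqP: uvn; apply: psi_inj => g.
have [w <-] := pi_sur g.
apply: (free_hom_ext bF (f := psi uv \o pi) (g := psi uv' \o pi)).
- exact: hom_comp.
- exact: hom_comp.
move=> k; apply: wreath_eq => [|j]; first by rewrite !psi_top.
apply/eqP; apply/negPn/negP => ne; apply: none; exists k, j.
by rewrite ffunE /=; move: ne => /=; case: (labels _ _); case: (labels _ _).
Qed.

(** * Transfer along parafree approximations *)

Lemma lower_central_hom (G H : groupType) (f : G -> H) i x :
  group_hom f -> lower_central G i x -> lower_central H i (f x).
Proof.
move=> fM; case: i => [|i]; first by [].
move: i x; apply: (@lower_central_filtration G
  (fun i => f @^-1` lower_central H i.+1)) => [i|//|i x y Bx].
  by apply: is_subgroup_preim => //; case: (lower_central_normal H i.+1).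
by rewrite /= (homR fM) => B [_]; apply; exists (f x) => //; exists (f y).
Qed.

Lemma lower_central2_abelian (G : groupType) :
  (forall x y : G, commute x y) -> lower_central G 2 = [set 1].
Proof.
move=> ab; apply/seteqP; split=> [|_ ->]; last first.
  by case: (lower_central_normal G 2) => -[].
apply: subgroup_gen_sub => [|_ [x _ [y _ <-]]] /=; last exact/eqP/commgP.
by split=> // [x y -> ->|x ->]; rewrite ?mulg1 ?invg1.
Qed.

Section Parafree.
Variables (G F : groupType).
Variable phi : forall i, quotient_group (lcs F i) -> quotient_group (lcs G i).
Hypothesis phi_iso : forall i, (1 <= i)%N -> group_iso (@phi i).
Hypothesis phi_compat : forall i, (2 <= i)%N ->
  forall q : quotient_group (lcs F i),
  quotient_map (lcs G i.-1) (@phi i q) =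
  @phi i.-1 (quotient_map (lcs F i.-1) q).

(** A relation, because neither group need map to the other: only their
    nilpotent quotients are identified. *)
Definition matches i (g : G) (x : F) : Prop :=
  @phi i (quotient_proj (lcs F i) x) = quotient_proj (lcs G i) g.

Lemma matches_l i g : (1 <= i)%N -> exists x, matches i g x.
Proof.
move=> /phi_iso[_ [f _ fK]]; exists (repr (f (quotient_proj (lcs G i) g))).
by rewrite /matches quotient_proj_repr fK.
Qed.

Lemma matches_r i x : exists g, matches i g x.
Proof.
exists (repr (@phi i (quotient_proj _ x))).
by rewrite /matches quotient_proj_repr.
Qed.

Lemma matchesM i g h x y : (1 <= i)%N ->
  matches i g x -> matches i h y -> matches i (g * h) (x * y).
Proof.
move=> /phi_iso[pM _] gx hy.
by rewrite /matches quotient_proj_hom pM gx hy -quotient_proj_hom.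
Qed.

Lemma matches_down i j g x : (1 <= j <= i)%N -> matches i g x -> matches j g x.
Proof.
elim: i => [|i IH]; first by case: j.
move=> /andP[j1]; rewrite leq_eqVlt => /orP[/eqP -> //|]; rewrite ltnS => ji.
move=> gx; apply: IH; first by rewrite j1 ji.
have i2 : (2 <= i.+1)%N by lia.
have := phi_compat i2 (quotient_proj (lcs F i.+1) x); rewrite gx.
by rewrite !quotient_mapE; [move/esym|exact: lower_central_sub..].
Qed.

(** A homomorphism to a nilpotent group factors through some [F / gamma_i(F)],
    which is also [G / gamma_i(G)]. *)
Lemma transfer_hom (W : groupType) (theta : F -> W) i :
    (1 <= i)%N -> lower_central W i = [set 1] -> group_hom theta ->
  exists2 thetaG : G -> W, group_hom thetaG &
    forall g x, matches i g x -> thetaG g = theta x.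
Proof.
move=> i1 Wi thetaM; have [pM [f fK f'K]] := phi_iso i1.
have [x xi|q qM qE] := @quotient_lift _ _ (lcs F i) theta thetaM.
  by have := lower_central_hom thetaM xi; rewrite Wi.
exists (q \o f \o quotient_proj _) => [|g x gx]; last by rewrite /= -gx fK qE.
apply: hom_comp; first exact: quotient_proj_hom.
by apply: hom_comp qM => x y; rewrite -{1}[x]f'K -{1}[y]f'K -pM fK.
Qed.

End Parafree.

(** * Parafree groups *)

Lemma intg_abelian (m n : intg) : commute m n.
Proof. by rewrite /commute !intgM addrC. Qed.

Section FreeModel.
Variables (G F : groupType).
Variable phi : forall i, quotient_group (lcs F i) -> quotient_group (lcs G i).
Hypothesis phi_iso : forall i, (1 <= i)%N -> group_iso (@phi i).
Hypothesis phi_compat : forall i, (2 <= i)%N ->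
  forall q : quotient_group (lcs F i),
  quotient_map (lcs G i.-1) (@phi i q) =
  @phi i.-1 (quotient_map (lcs F i.-1) q).
Variables (X : Type) (b : X -> F).
Hypothesis bF : free_basis b.

(** The first coordinate of [F] is an epimorphism to an infinite cyclic group,
    hence so is its transfer to [G]. *)
Lemma transfer_coordinate (x0 : X) :
  exists (chi : G -> intg) (eps : F -> intg) (tau : G),
    [/\ group_hom chi, group_hom eps,
        forall x, eps (b x) = if `[< x = x0 >] then Posz 1 else Posz 0,
        matches phi 2 tau (b x0) &
        forall g x, matches phi 2 g x -> chi g = eps x].
Proof.
have [eps epsM epsb] := @free_lift _ _ _ bF intg
  (fun x => if `[< x = x0 >] then Posz 1 else Posz 0).
have [chi chiM chiE] :=
  transfer_hom phi_iso (i := 2) isT (lower_central2_abelian intg_abelian) epsM.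
have [tau tauP] := matches_r phi 2 (b x0).
by exists chi, eps, tau.
Qed.

(** The window length [L.*2.+1] is known before the cycle length [N], which is
    then chosen as a power of 2 that exceeds the number of window bits. *)
Lemma large_of_rank_ge2 (x0 x1 : X) :
  x0 <> x1 -> finitely_presented G -> large G.
Proof.
move=> x01 /finite_presentation[s [Fs [bs [R [pi]]]]].
move=> [bsF piM pi_sur piR pi_lift].
have [chi [eps [tau [chiM epsM epsb tauP chiE]]]] := transfer_coordinate x0.
have [Q [e eQ]] := free_rank2 bF x01.
have chi_tau : chi tau = Posz 1 by rewrite (chiE _ _ tauP) epsb asboolT.
have [L largeG] :=
  large_of_lamplighter bsF piM pi_sur piR pi_lift chiM chi_tau eQ.
pose k := (s * L.*2.+1)%N; pose N := (2 ^ k.+1)%N.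
have kN : (k < N)%N by apply: leq_trans (ltn_expl k.+1 _).
have N1 : (1 < N)%N by rewrite -{1}(expn0 2) ltn_exp2l.
(* The homomorphisms sending [x0] to [(u, 1)] and [x1] to [(v, 0)]. *)
pose gen (uv : {ffun 'Z_N -> bool} * {ffun 'Z_N -> bool}) x : lamplighter N :=
  if `[< x = x0 >] then Wreath (shift_action N) (Posz 1 : intg) uv.1
  else if `[< x = x1 >] then Wreath (shift_action N) (1 : intg) uv.2 else 1.
have /choice[psi psiP] : forall uv, exists psi : G -> lamplighter N,
    [/\ group_hom psi, forall g, top (psi g) = chi g &
        forall g x, matches phi N.+2 g (b x) -> psi g = gen uv x].
  move=> uv; have [theta thetaM thetab] := free_lift bF (gen uv).
  have [psi psiM psiE] :=
    transfer_hom phi_iso (i := N.+2) isT (lamplighter_nilpotent k) thetaM.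
  exists psi; split=> // [g|g x gx]; last by rewrite (psiE _ _ gx) thetab.
  have [x gx] := matches_l phi_iso (i := N.+2) g isT.
  rewrite (psiE _ _ gx) (chiE _ _ (matches_down phi_compat _ gx)) //.
  apply: (free_hom_ext bF (f := fun x => top (theta x)) (g := eps)) => //.
    by move=> y z; rewrite thetaM topM.
  by move=> y; rewrite thetab epsb /gen; case: ifP => // _; case: ifP.
have [| | |d [dM d_top d_tau d_far d_ex]] :=
    windowed_cocycle (chi := chi) tau (L := L) bsF piM pi_sur N1 kN
      (psi := psi).
- by move=> uv; case: (psiP uv).
- by move=> uv; case: (psiP uv).
- move=> [u v] [u' v'] E.
  have [g0 g0P] := matches_r phi N.+2 (b x0).
  have [g1 g1P] := matches_r phi N.+2 (b x1).
  have [_ _ H] := psiP (u, v); have [_ _ H'] := psiP (u', v').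
  have := E g0; rewrite (H _ _ g0P) (H' _ _ g0P) /gen asboolT // => -[->].
  have := E g1; rewrite (H _ _ g1P) (H' _ _ g1P) /gen asboolF ?asboolT //.
    by case=> ->.
  exact/nesym.
exact: (largeG N d).
Qed.

Lemma infinite_cyclic_of_rank1 (x0 : X) :
  (forall x, x = x0) -> residually_nilpotent G -> infinite_cyclic G.
Proof.
move=> xx0 resG.
have [chi [eps [tau [chiM epsM epsb tauP chiE]]]] := transfer_coordinate x0.
have chi_tau n : chi (tau ^+ n) = Posz n.
  rewrite (homX chiM) (chiE _ _ tauP) epsb asboolT //.
  by elim: n => [//|n IH]; rewrite expgSr IH intgM -PoszD addn1.
have [T1 TM TV] := is_subgroup_gen [set tau].
have Ttau : subgroup_gen [set tau] tau by move=> B [_]; apply.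
pose Z (x : F) : set F := [set y | commute x y].
have sZ (x : F) : is_subgroup (Z x).
  split=> [|y z|y]; [exact: commute1|exact: commuteM|exact: commuteV].
have abF (x y : F) : commute x y.
  apply: (free_generated bF (sZ x)) => z; rewrite /Z /= (xx0 z).
  apply: commute_sym; apply: (free_generated bF (sZ (b x0))) => t.
  by rewrite (xx0 t).
have G2 g : lower_central G 2 g -> g = 1.
  (* [gamma_2(G)] lies in every [gamma_i(G)], as the quotients are abelian. *)
  move=> g2; apply: contrapT => /resG[M [[i Mi] Mg]]; apply: Mg.
  have gi : lower_central G i g.
    case: i {Mi} => [//|[//|i]].
    have [pM [f fK f'K]] := phi_iso (i := i.+2) isT.
    apply: (subgroup_gen_sub _ _ g2).
      by case: (lower_central_normal G i.+2).
    move=> _ [x _ [y _ <-]].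
    have abq :
        commute (quotient_proj (lcs G i.+2) x) (quotient_proj (lcs G i.+2) y).
      rewrite -[quotient_proj _ x]f'K -[quotient_proj _ y]f'K /commute -!pM.
      congr (@phi _ _); move: (f _) (f _) => p q.
      rewrite -[p]quotient_proj_repr -[q]quotient_proj_repr.
      by rewrite -!quotient_proj_hom abF.
    have : quotient_proj (lcs G i.+2) 1 = quotient_proj (lcs G i.+2) [~ x, y].
      rewrite (homR (quotient_proj_hom _)) (hom1 (quotient_proj_hom _)).
      exact/esym/eqP/commgP.
    by move=> /quotient_projP; rewrite invg1 mul1g.
  have := lower_central_hom (quotient_proj_hom M) gi.
  rewrite Mi /= -(hom1 (quotient_proj_hom M)) => /esym/quotient_projP.
  by rewrite invg1 mul1g.
split.
  move=> finG; apply: infinite_nat.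
  apply: sub_finite_set
    (finite_image (fun g => `|(chi g : int)|%N) finG) => n _.
  by exists (tau ^+ n); rewrite ?chi_tau.
exists tau; apply/seteqP; split=> // g _.
have [x gx] := matches_l phi_iso (i := 2) g isT.
have [h Th hx] : exists2 h, subgroup_gen [set tau] h & matches phi 2 h x.
  have [pM _] := phi_iso (i := 2) isT.
  apply: (free_generated bF
    (A := [set x | exists2 h, subgroup_gen [set tau] h & matches phi 2 h x])).
  - split=> [|y z [h Th hy] [h' Th' hz]|y [h Th hy]].
    + exists 1 => //; rewrite /matches !(hom1 (quotient_proj_hom _)).
      exact: hom1.
    + by exists (h * h'); [exact: TM|exact: matchesM].
    + exists h^-1; first exact: TV.
      by rewrite /matches !(homV (quotient_proj_hom _)) (homV pM) hy.
  - by move=> y; rewrite (xx0 y); exists tau.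
have /quotient_projP /G2 E :
    quotient_proj (lcs G 2) g = quotient_proj (lcs G 2) h.
  by rewrite -gx -hx.
by rewrite (_ : g = h) //; apply: (mulgI g^-1); rewrite E mulVg.
Qed.

End FreeModel.

Theorem corollary1p4 (G : groupType) :
  finitely_presented G -> parafree G -> large G \/ infinite_cyclic G.
Proof.
move=> fpG [[F [phi [[X [b bF]] [y y1] phi_iso phi_compat]]] resG].
have [x0 _] : exists x0 : X, True.
  apply: contrapT => noX; apply: y1.
  apply: (free_hom_ext bF (f := id) (g := fun=> 1)) => //.
  - by move=> u v; rewrite mulg1.
  - by move=> x; case: noX; exists x.
have [[x1 x01]|one] := pselect (exists x1, x0 <> x1).
  left; exact: (large_of_rank_ge2 phi_iso phi_compat bF x01 fpG).
right; apply: (infinite_cyclic_of_rank1 phi_iso bF (x0 := x0) _ resG) => x.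
by apply: contrapT => xx0; apply: one; exists x; exact/nesym.
Qed.
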